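(* Assume that $\mathrm{MA(countable)}$ holds. Then there exists a subset $X$ of $2^\omega$ that is not a $G_\delta$ subset of $2^\omega$ and such that $X^\omega$ (with the product topology) is countable dense homogeneous.
   Context: A (separable metrizable) space $Y$ is countable dense homogeneous if for every pair $(D,E)$ of countable dense subsets of $Y$ there exists a homeomorphism $f:Y\to Y$ such that $f[D]=E$. $\mathrm{MA(countable)}$ (Martin's Axiom for countable posets) is the statement: for every non-empty countable partially ordered set $\mathbb{P}$ and every collection $\mathcal{D}$ of dense subsets of $\mathbb{P}$ with $|\mathcal{D}|<\mathfrak{c}=2^{\aleph_0}$, there is a filter $G\subseteq\mathbb{P}$ that meets every element of $\mathcal{D}$. *)

(* Defs.v *)
From mathcomp Require Import all_boot all_order all_algebra.
From mathcomp Require Import all_classical all_reals all_analysis.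

Set Implicit Arguments.
Unset Strict Implicit.
Unset Printing Implicit Defensive.

Local Open Scope classical_set_scope.
Local Open Scope card_scope.

Definition homeomorphism (S T : topologicalType) (f : S -> T) : Prop :=
  continuous f /\
  exists g : T -> S, [/\ continuous g, cancel f g & cancel g f].

(* Separability and metrizability of Y are a convention on the spaces under
   consideration, not part of the property. *)
Definition countable_dense_homogeneous (Y : topologicalType) : Prop :=
  forall D E : set Y,
    countable D -> dense D -> countable E -> dense E ->
    exists2 f : Y -> Y, homeomorphism f & f @` D = E.

Definition card_lt (T U : Type) (A : set T) (B : set U) : Prop :=
  A #<= B /\ ~ (B #<= A).

Section Posets.
Context {d : Order.disp_t} {P : porderType d}.

(* Forcing convention: smaller elements are stronger. *)
Definition poset_dense (D : set P) : Prop :=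
  forall p : P, exists2 q : P, D q & (q <= p)%O.

Definition poset_filter (G : set P) : Prop :=
  [/\ G !=set0,
      forall p q : P, G p -> (p <= q)%O -> G q &
      forall p q : P, G p -> G q ->
        exists r : P, [/\ G r, (r <= p)%O & (r <= q)%O]].

End Posets.

Definition MA_countable : Prop :=
  forall (d : Order.disp_t) (P : porderType d),
    [set: P] !=set0 -> countable [set: P] ->
    forall DD : set (set P),
      (forall D, DD D -> poset_dense D) ->
      card_lt DD [set: nat -> bool] ->
      exists2 G : set P, poset_filter G & forall D, DD D -> G `&` D !=set0.

(* X^omega: the product topology on sequences of points of X, where X carries
   the subspace topology (the canonical topology on [set_type X]). *)
Definition omega_power (T : topologicalType) (X : set T) : topologicalType :=
  prod_topology (fun _ : nat => set_type X).

(* Main.v *)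
From HB Require Import structures.
Require Import Defs.
From mathcomp Require Import all_boot all_order all_algebra.
From mathcomp Require Import all_classical all_reals all_analysis borel_hierarchy.
From mathcomp Require Import wochoice.
From mathcomp Require Import zify.
From Stdlib Require Cantor.

(** The space X is a maximal ideal I of subsets of nat which is a P-ideal: every
    sequence of members of I has a pseudo-union in I, that is, a member that
    contains each term up to finitely many points (I is dual to a P-point
    ultrafilter).

    Not G-delta. Complementation is a homeomorphism of the Cantor space that
    carries I onto its complement. Both are dense because I contains the finite
    sets, so if I were G-delta the Baire category argument would give a set in I
    whose complement is also in I ([maximal_ideal_not_Gdelta]).

    Countable dense homogeneity. Along a bijection nat * nat = nat, the power
    of I is again an ideal J of subsets of nat, namely the sets all of whose rows
    lie in I. J inherits the P-property, and by maximality of I it swallows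
    infinitely many intervals of any prescribed growth
    ([power_ideal_swallows]). Given countable dense subsets D and E of J, these
    two properties produce one set A in J such that every element of D and E is
    almost contained in A and such that any finite pattern on an initial segment
    is realised by elements of D, and of E, that live in A from there on
    ([dense_modulo_exists]). A back-and-forth construction then yields an
    isometry h of the Cantor space with h[D] = E that leaves all coordinates
    outside A unchanged ([isometry_matching]). As h x differs from x only inside
    the member A of the ideal J, h maps J onto J, and its restriction is the
    required homeomorphism.

    Existence of I. Subsets of nat are well-ordered so that continuum many
    stages have fewer than continuum many predecessors, and every sequence (x_k)
    of sets is handed to one such stage. If finitely many of the x_k and of the
    sets chosen before never cover nat up to a finite set, a pseudo-union of
    the x_k with the same property is added. It is read off a sequence g of natural
    numbers that is generic for the poset of finite sequences: almost all of
    x_k is kept, with the points removed determined by g, and fewer than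
    continuum many dense sets ensure that no finite union of previous sets
    becomes cofinite ([pseudo_union_exists]). Constant sequences make the
    resulting ideal maximal, and arbitrary sequences make it a P-ideal
    ([maximal_p_ideal_exists]). Counting finite unions needs the fact that an
    infinite set has as many finite words as elements ([card_words]). *)

Set Implicit Arguments.
Unset Strict Implicit.
Unset Printing Implicit Defensive.

Local Open Scope classical_set_scope.
Local Open Scope card_scope.

(** * Isometries of the Cantor space matching two dense sets *)
Definition agree (n : nat) (x y : nat -> bool) := forall m, (m < n)%N -> x m = y m.

Lemma agree_sym n x y : agree n x y -> agree n y x.
Proof. by move=> xy m /xy. Qed.

Lemma agree_trans n x y z : agree n x y -> agree n y z -> agree n x z.
Proof. by move=> xy yz m mn; rewrite xy ?yz. Qed.

Lemma agreeW m n x y : (m <= n)%N -> agree n x y -> agree m x y.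
Proof. by move=> mn xy k km; apply: xy; exact: leq_trans mn. Qed.

Lemma agreeS n x y : agree n.+1 x y <-> agree n x y /\ x n = y n.
Proof.
split=> [xy|[xy xyn] m]; first by split; [exact: agreeW xy | exact: xy].
by rewrite ltnS leq_eqVlt => /orP[/eqP ->|/xy].
Qed.

Lemma agree_eq x y : (forall n, agree n x y) -> x = y.
Proof. by move=> xy; apply/funext => n; apply: (xy n.+1). Qed.

(** Finite approximations are kept as words of pairs, so that a property P of
    finite partial matchings is all that has to be preserved. *)
Lemma back_and_forth (X Y : choiceType) (D : set X) (E : set Y)
    (P : seq (X * Y) -> Prop) :
  countable D -> countable E -> P [::] ->
  (forall l d, P l -> D d -> exists2 e, E e & P ((d, e) :: l)) ->
  (forall l e, P l -> E e -> exists2 d, D d & P ((d, e) :: l)) ->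
  exists L : nat -> seq (X * Y),
    [/\ forall n, P (L n), forall m n, (m <= n)%N -> {subset L m <= L n},
        forall d, D d -> exists n e, E e /\ (d, e) \in L n
      & forall e, E e -> exists n d, D d /\ (d, e) \in L n].
Proof.
move=> /countable_injP[f fI] /countable_injP[g gI] P0 forth back.
(* The n-th element of D in the enumeration f is treated at stage n, and f
   being injective on D there is at most one. *)
have stepX l n : exists l', P l -> [/\ P l', {subset l <= l'} &
    forall d, D d -> f d = n -> exists2 e, E e & (d, e) \in l'].
  have [[d [Dd fdn]]|nod] := pselect (exists d, D d /\ f d = n); last first.
    by exists l => Pl; split=> // d Dd fd; case: nod; exists d.
  have [Pl|nPl] := pselect (P l); last by exists l => /nPl.
  have [e Ee Pl'] := forth _ _ Pl Dd; exists ((d, e) :: l) => _; split=> //.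
    by move=> p pl; rewrite inE pl orbT.
  move=> d' Dd' fd'; exists e => //.
  by rewrite (fI d' d) ?inE ?eqxx // fd' fdn.
have stepY l n : exists l', P l -> [/\ P l', {subset l <= l'} &
    forall e, E e -> g e = n -> exists2 d, D d & (d, e) \in l'].
  have [[e [Ee gen]]|noe] := pselect (exists e, E e /\ g e = n); last first.
    by exists l => Pl; split=> // e Ee ge; case: noe; exists e.
  have [Pl|nPl] := pselect (P l); last by exists l => /nPl.
  have [d Dd Pl'] := back _ _ Pl Ee; exists ((d, e) :: l) => _; split=> //.
    by move=> p pl; rewrite inE pl orbT.
  move=> e' Ee' ge'; exists d => //.
  by rewrite (gI e' e) ?inE ?eqxx // ge' gen.
have [F FP] := choice (fun ln : seq (X * Y) * nat => stepX ln.1 ln.2).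
have [G GP] := choice (fun ln : seq (X * Y) * nat => stepY ln.1 ln.2).
pose L := fix L n := if n is n'.+1 then G (F (L n', n'), n') else [::].
have PL n : P (L n).
  elim: n => //= n IH.
  by case: (FP (L n, n) IH) => /= PF _ _; case: (GP (F (L n, n), n) PF).
have LS n : {subset L n <= L n.+1}.
  move=> p pL /=; case: (FP (L n, n) (PL n)) => /= PF sF _.
  by case: (GP (F (L n, n), n) PF) => /= _ sG _; apply/sG/sF.
exists L; split=> //.
- move=> m n; elim: n => [|n IH]; first by rewrite leqn0 => /eqP->.
  by rewrite leq_eqVlt => /orP[/eqP->//|/IH sub p /sub /LS].
- move=> d Dd; case: (FP (L (f d), f d) (PL _)) => /= PF sF /(_ d Dd erefl)[e Ee de].
  exists (f d).+1, e; split=> //=.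
  by case: (GP (F (L (f d), f d), f d) PF) => /= _ sG _; apply: sG.
- move=> e Ee; case: (FP (L (g e), g e) (PL _)) => /= PF _ _.
  case: (GP (F (L (g e), g e), g e) PF) => /= _ _ /(_ e Ee erefl)[d Dd de].
  by exists (g e).+1, d.
Qed.

(** Call two sets equivalent when they agree outside A. The condition means that D
    is contained in the union of the classes of the sets with finite part outside
    A, and is dense in each of these classes. *)
Definition dense_modulo (A : nat -> bool) (D : set (nat -> bool)) :=
  (forall d, D d -> exists N, forall n, (N <= n)%N -> d n -> A n) /\
  forall N t, exists2 d, D d &
    agree N d t /\ forall n, (N <= n)%N -> d n -> A n.

Definition isometric_pairs (A : nat -> bool) (l : seq ((nat -> bool) * (nat -> bool))) :=
  (forall p, p \in l -> forall n, ~~ A n -> p.1 n = p.2 n) /\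
  forall p q, p \in l -> q \in l ->
    forall n, agree n p.1 q.1 <-> agree n p.2 q.2.

Lemma uniform_disagreement (s : seq (nat -> bool)) d : d \notin s ->
  exists N, forall x, x \in s -> ~ agree N d x.
Proof.
move=> ds.
have /choice[f fP] x : exists N, d != x -> ~ agree N d x.
  have [[N nd]|nd] := pselect (exists N, ~ agree N d x); first by exists N.
  exists 0 => /eqP[]; apply: agree_eq => n.
  by apply: contrapT => ndn; apply: nd; exists n.
exists (\max_(x <- s) f x) => x xs /(agreeW (leq_bigmax_seq (F := f) x xs isT)).
by apply: fP; apply: contraNneq ds => ->.
Qed.

(** The image of d is forced on an initial segment by the pairs already matched:
    whenever d agrees with some d' below n, the bits of d and of its image at n
    must differ exactly when those of d' and its partner do. The resulting
    pattern never changes a bit outside A, and density of E modulo A realises it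
    by an element of E. *)
Lemma isometric_pairs_extend A D E l d :
  dense_modulo A D -> dense_modulo A E ->
  isometric_pairs A l -> (forall p, p \in l -> E p.2) -> D d ->
  exists2 e, E e & isometric_pairs A ((d, e) :: l).
Proof.
move=> [fD _] [_ dE] [lA lI] lE Dd.
suff [e Ee [eA eI]] : exists2 e, E e & (forall n, ~~ A n -> d n = e n) /\
    forall p, p \in l -> forall n, agree n d p.1 <-> agree n e p.2.
  exists e => //; split=> [p|p q]; first by rewrite inE => /predU1P[->|/lA].
  rewrite !inE => /predU1P[->|pl] /predU1P[->|ql] n /=.
  - by [].
  - exact: eI.
  - by split=> /agree_sym H; apply: agree_sym; apply/(eI p pl n).
  - exact: lI.
have [/mapP[p pl ->]|dl] := boolP (d \in map fst l).
  by exists p.2; [exact: lE | split=> [n|q ql n]; [exact: lA | exact: lI]].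
have [N0 dA] := fD d Dd.
have [N1 dN1] := uniform_disagreement dl.
(* t is the forced pattern; it agrees with d wherever no matched element
   agrees with d so far. *)
pose twist n := `[< exists2 p, p \in l & agree n d p.1 /\ p.1 n != p.2 n >].
pose t n := d n (+) twist n.
have tA n : ~~ A n -> t n = d n.
  move=> nA; rewrite /t; suff -> : twist n = false by rewrite addbF.
  by apply/asboolP => -[p pl [_ /eqP[]]]; exact: lA.
have tI p : p \in l -> forall n, agree n d p.1 <-> agree n t p.2.
  move=> pl; elim=> [|n IH]; first by [].
  suff twistE : agree n d p.1 -> twist n = (p.1 n != p.2 n).
    split=> /agreeS[]; rewrite /t => dp dpn; apply/agreeS.
      split; first exact/IH.
      by rewrite twistE // dpn; case: (p.1 n); case: (p.2 n).
    have /IH dp1 := dp; split=> //; move: dpn; rewrite twistE //.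
    by case: (d n); case: (p.1 n); case: (p.2 n).
  move=> dp; apply/asboolP/idP => [[q ql [dq qn]]|pn]; last by exists p.
  have pqn := agree_trans (agree_sym dp) dq.
  have pqn2 := (lI p q pl ql n).1 pqn.
  have /(_ n.+1) := lI p q pl ql; rewrite !agreeS => -[H1 H2].
  apply: contraNneq qn => pn; apply/eqP.
  case: (eqVneq (p.1 n) (q.1 n)) => [pq|/eqP npq].
    by rewrite -pq pn; apply: (H1 (conj pqn pq)).2.
  case: (eqVneq (p.2 n) (q.2 n)) => [pq|/eqP npq2].
    by case: npq; apply: (H2 (conj pqn2 pq)).2.
  by move: npq npq2 pn; case: (p.1 n); case: (p.2 n); case: (q.1 n); case: (q.2 n).
(* Below N the pattern settles all comparisons with matched elements, and from N
   on d lies in A, so e may be any element of E inside A there. *)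
pose N := maxn N0 N1.
have [e Ee [et eA]] := dE N t; exists e => //.
have NA n : (N <= n)%N -> ~~ A n -> d n = false.
  rewrite geq_max => /andP[N0n _] nA; apply: contraNF nA; exact: dA.
split=> [n nA|p pl n].
  have [nN|Nn] := ltnP n N; first by rewrite et // tA.
  by rewrite NA //; apply/esym; apply: contraNF nA; exact: eA.
have [nN|/ltnW Nn] := leqP n N.
  have etn := agreeW nN et; rewrite tI //.
  by split; apply: agree_trans => //; exact: agree_sym.
have nd : ~ agree N d p.1.
  move=> /(agreeW (leq_maxr _ _)); apply: dN1; exact: map_f.
split=> [/(agreeW Nn)//|/(agreeW Nn) ep]; case: nd.
by apply/tI => //; apply: agree_trans ep; exact: agree_sym.
Qed.

Lemma isometric_pairs_swap A l : isometric_pairs A l ->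
  isometric_pairs A [seq (p.2, p.1) | p <- l].
Proof.
move=> [lA lI]; split=> [_ /mapP[p pl ->] n nA|_ _ /mapP[p pl ->] /mapP[q ql ->] n].
  by rewrite /= lA.
by split=> /(lI p q pl ql n).
Qed.

(** An isometric relation with dense domain determines a limit map, since the
    first n bits of h x can be copied from the partner of any element agreeing
    with x on n bits. *)
Lemma isometry_extension A (R : (nat -> bool) -> (nat -> bool) -> Prop) :
  (forall n t, exists d e, R d e /\ agree n d t) ->
  (forall d e, R d e -> forall n, ~~ A n -> d n = e n) ->
  (forall d e d' e', R d e -> R d' e' -> forall n, agree n d d' -> agree n e e') ->
  exists h : (nat -> bool) -> (nat -> bool),
    [/\ forall d e x n, R d e -> agree n x d -> agree n (h x) e,
        forall n x y, agree n x y -> agree n (h x) (h y)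
      & forall x n, ~~ A n -> h x n = x n].
Proof.
move=> Rd RA RI.
have /choice[F FP] (nt : nat * (nat -> bool)) :
    exists de, R de.1 de.2 /\ agree nt.1 de.1 nt.2.
  by have [d [e H]] := Rd nt.1 nt.2; exists (d, e).
pose h x n := (F (n.+1, x)).2 n.
have hP d e x n : R d e -> agree n x d -> agree n (h x) e.
  move=> de xd m mn; have [de' dx] := FP (m.+1, x).
  by apply: (RI _ _ _ _ de' de m.+1) => //; apply: agree_trans dx (agreeW _ xd).
exists h; split=> // [n x y xy|x n nA].
  have [de yd] := FP (n, y); apply: agree_trans (hP _ _ _ _ de _) _.
    by apply: agree_trans xy _; exact: agree_sym.
  by apply/agree_sym/(hP _ _ _ _ de)/agree_sym.
have [de xd] := FP (n.+1, x).
by have /= <- := xd n (ltnSn n); rewrite /h -(RA _ _ de).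
Qed.

Lemma isometry_matching A D E : countable D -> countable E ->
  dense_modulo A D -> dense_modulo A E ->
  exists h g : (nat -> bool) -> (nat -> bool),
  [/\ cancel h g, cancel g h,
      (forall n x y, agree n x y -> agree n (h x) (h y)) /\
      (forall n x y, agree n x y -> agree n (g x) (g y)),
      (forall x n, ~~ A n -> h x n = x n) /\ (forall x n, ~~ A n -> g x n = x n)
    & (forall d, D d -> E (h d)) /\ (forall e, E e -> D (g e))].
Proof.
move=> cD cE dD dE.
pose P (l : seq ((nat -> bool) * (nat -> bool))) :=
  isometric_pairs A l /\ forall p, p \in l -> D p.1 /\ E p.2.
have [|||L [LP Lmono LD LE]] := @back_and_forth _ _ D E P cD cE.
- by split=> //; split.
- move=> l d [lI lDE] Dd.
  have [|e Ee deI] := isometric_pairs_extend dD dE lI _ Dd.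
    by move=> p /lDE[].
  exists e => //; split=> // p; rewrite inE => /predU1P[->//|/lDE//].
- move=> l e [lI lDE] Ee.
  have [|d Dd /isometric_pairs_swap] :=
      isometric_pairs_extend dE dD (isometric_pairs_swap lI) _ Ee.
    by move=> _ /mapP[p /lDE[Dp _] ->].
  rewrite /= -map_comp (eq_map (g := id)) ?map_id => [deI|[]//].
  exists d => //; split=> // p; rewrite inE => /predU1P[->//|/lDE//].
pose R d e := exists n, (d, e) \in L n.
have Rcommon d e d' e' : R d e -> R d' e' ->
    exists n, (d, e) \in L n /\ (d', e') \in L n.
  move=> [m dm] [n dn]; exists (maxn m n); split.
    by apply: Lmono dm; exact: leq_maxl.
  by apply: Lmono dn; exact: leq_maxr.
have RI d e d' e' n : R d e -> R d' e' -> agree n d d' <-> agree n e e'.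
  move=> de de'; have [m [dem dem']] := Rcommon _ _ _ _ de de'.
  by have [[_ lI] _] := LP m; exact: (lI _ _ dem dem').
have RA d e : R d e -> forall n, ~~ A n -> d n = e n.
  by move=> [m dem] n nA; have [[lA _] _] := LP m; exact: (lA _ dem).
have RDE d e : R d e -> D d /\ E e.
  by move=> [m dem]; have [_ /(_ _ dem)] := LP m.
have RDd n t : exists d e, R d e /\ agree n d t.
  have [d Dd [dt _]] := dD.2 n t; have [m [e [_ de]]] := LD d Dd.
  by exists d, e; split=> //; exists m.
have REd n t : exists e d, R d e /\ agree n e t.
  have [e Ee [et _]] := dE.2 n t; have [m [d [_ de]]] := LE e Ee.
  by exists e, d; split=> //; exists m.
have [|h [hR hI hA]] := isometry_extension RDd RA.
  by move=> d e d' e' de de' n /(RI _ _ _ _ _ de de').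
have [||g [gR gI gA]] := @isometry_extension A (fun e d => R d e) REd.
- by move=> e d de n nA; rewrite (RA _ _ de).
- by move=> e d e' d' de de' n /(RI _ _ _ _ _ de de').
exists h, g; split=> //.
- move=> x; apply: agree_eq => n; have [d [e [de dx]]] := RDd n x.
  have hxe := hR _ _ _ _ de (agree_sym dx).
  exact: agree_trans (gR _ _ _ _ de hxe) dx.
- move=> x; apply: agree_eq => n; have [e [d [de ex]]] := REd n x.
  have gxd := gR _ _ _ _ de (agree_sym ex).
  exact: agree_trans (hR _ _ _ _ de gxd) ex.
split=> [d Dd|e Ee].
  have [m [e [Ee de]]] := LD d Dd; rewrite (_ : h d = e) //.
  by apply: agree_eq => n; apply: hR => //; exists m.
have [m [d [Dd de]]] := LE e Ee; rewrite (_ : g e = d) //.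
by apply: agree_eq => n; apply: (gR _ d) => //; exists m.
Qed.

(** * Ideals of sets of natural numbers *)
Definition almost_le (x a : nat -> bool) :=
  exists N, forall n, (N <= n)%N -> x n -> a n.

Lemma almost_leW (x a b : nat -> bool) :
  (forall n, a n -> b n) -> almost_le x a -> almost_le x b.
Proof. by move=> ab [N xa]; exists N => n /xa xan /xan /ab. Qed.

Definition ideal (I : set (nat -> bool)) :=
  [/\ forall x y : nat -> bool, (forall n, x n -> y n) -> I y -> I x,
      forall x y, I x -> I y -> I (fun n => x n || y n)
    & forall N, I (fun n => (n < N)%N)].

Definition maximal_ideal (I : set (nat -> bool)) :=
  [/\ ideal I, ~ I (fun=> true) & forall x : nat -> bool, I x \/ I (fun n => ~~ x n)].

Definition p_ideal (I : set (nat -> bool)) :=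
  forall x : nat -> nat -> bool, (forall k, I (x k)) ->
    exists2 a, I a & forall k, almost_le (x k) a.

(** For ideals containing the finite sets this is equivalent to being nonmeager
    in the Cantor space. *)
Definition swallows_intervals (I : set (nat -> bool)) :=
  forall f : nat -> nat, exists2 b, I b & forall N, exists2 n, (N <= n)%N &
    forall m, (n <= m < f n)%N -> b m.

Definition truncate (N : nat) (x : nat -> bool) n := (n < N)%N && x n.

Lemma agree_truncate N x : agree N (truncate N x) x.
Proof. by move=> m; rewrite /truncate => ->. Qed.

Lemma ideal_truncate I N x : ideal I -> I (truncate N x).
Proof. by move=> [dI _ /(_ N)]; apply: dI => n /andP[]. Qed.

Lemma p_ideal_countable I (D : set (nat -> bool)) :
  ideal I -> p_ideal I -> countable D -> D `<=` I ->
  exists2 a, I a & forall d, D d -> almost_le d a.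
Proof.
move=> idI pI /countable_injP[f fI] DI.
pose x k := xget (truncate 0 xpred0) [set d | D d /\ f d = k].
have [k|a Ia xa] := pI x.
  by rewrite /x; case: xgetP => [_ _ [/DI]|_] //; exact: ideal_truncate.
exists a => // d Dd; rewrite (_ : d = x (f d)) // /x.
case: xgetP => [y _ [Dy fy]|/(_ d)/=[]//].
by apply: fI; rewrite ?inE.
Qed.

(** There are only finitely many patterns of length n, so one bound serves for
    all of them. *)
Lemma uniform_density (a : nat -> bool) (D : set (nat -> bool)) :
  (forall N t, exists2 d, D d & agree N d t) ->
  (forall d, D d -> almost_le d a) ->
  forall n, exists M, forall t, exists2 d, D d &
    agree n d t /\ forall m, (M <= m)%N -> d m -> a m.
Proof.
move=> dD Da n.
have /choice[M MP] (u : n.-tuple bool) : exists M, exists2 d, D d &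
    agree n d (nth false u) /\ forall m, (M <= m)%N -> d m -> a m.
  have [d Dd du] := dD n (nth false u).
  by have [M dM] := Da d Dd; exists M, d.
exists (\max_(u : n.-tuple bool) M u) => t.
have [d Dd [dt da]] := MP [tuple t i | i < n]; exists d => //; split.
  move=> m mn; rewrite dt // -[m]/(val (Ordinal mn)).
  by rewrite -tnth_nth tnth_mktuple.
by move=> m Mm; apply: da; apply: leq_trans Mm; exact: leq_bigmax.
Qed.

(** The set A is the union of a pseudo-union a of D and E and of a member b that
    contains infinitely many of the intervals from n to f n, where f n bounds the
    part outside a of suitable elements of D and E with any prescribed pattern
    below n. To realise a pattern below N, it is padded with zeros up to the start
    n of such an interval: the element found has no points between N and n, lies
    in b between n and f n, and lies in a beyond f n. *)
Lemma dense_modulo_exists I (D E : set (nat -> bool)) :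
  ideal I -> p_ideal I -> swallows_intervals I ->
  countable D -> countable E -> D `<=` I -> E `<=` I ->
  (forall N t, exists2 d, D d & agree N d t) ->
  (forall N t, exists2 e, E e & agree N e t) ->
  exists A, [/\ I A, dense_modulo A D & dense_modulo A E].
Proof.
move=> idI pI sI cD cE DI EI dD dE.
have [_ uI _] := idI.
have [a1 Ia1 Da1] := p_ideal_countable idI pI cD DI.
have [a2 Ia2 Ea2] := p_ideal_countable idI pI cE EI.
pose a n := a1 n || a2 n.
have Da d : D d -> almost_le d a.
  by move=> /Da1; apply: almost_leW => n; rewrite /a => ->.
have Ea d : E d -> almost_le d a.
  by move=> /Ea2; apply: almost_leW => n; rewrite /a => ->; rewrite orbT.
have [f1 f1P] := choice (uniform_density dD Da).
have [f2 f2P] := choice (uniform_density dE Ea).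
have [b Ib bP] := sI (fun n => maxn (f1 n) (f2 n)).
exists (fun n => a n || b n).
have sound C f : (forall d, C d -> almost_le d a) ->
    (forall n t, exists2 d, C d & agree n d t /\
       forall m, (f n <= m)%N -> d m -> a m) ->
    (forall n, (f n <= maxn (f1 n) (f2 n))%N) ->
    dense_modulo (fun n => a n || b n) C.
  move=> Ca fP fle; split=> [d /Ca|N t].
    by apply: almost_leW => n ->.
  have [n Nn nb] := bP N; have [d Cd [dt da]] := fP n (truncate N t).
  exists d => //; split; first exact: agree_trans (agreeW Nn dt) (@agree_truncate _ _).
  move=> m Nm dm; have [mn|nm] := ltnP m n.
    by move: dm; rewrite dt // /truncate ltnNge Nm.
  have [mf|fm] := ltnP m (f n); last by rewrite da.
  by rewrite nb ?orbT // nm (leq_trans mf).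
split; first exact: uI (uI _ _ Ia1 Ia2) Ib.
- by apply: (sound _ f1) => // n; exact: leq_maxl.
- by apply: (sound _ f2) => // n; exact: leq_maxr.
Qed.

(** * The power of an ideal *)
Definition row (z : nat -> bool) (i j : nat) := z (Cantor.to_nat (i, j)).

(** Under this coding the product of countably many copies of I becomes again an ideal
    of sets of natural numbers. *)
Definition power_ideal (I : set (nat -> bool)) : set (nat -> bool) :=
  [set z | forall i, I (row z i)].

Lemma leq_to_nat i j : (i <= Cantor.to_nat (i, j))%N /\ (j <= Cantor.to_nat (i, j))%N.
Proof. by have /leP := Cantor.to_nat_non_decreasing i j; split; lia. Qed.

Lemma power_ideal_ideal I : ideal I -> ideal (power_ideal I).
Proof.
move=> [dI uI fI]; split.
- by move=> x y xy Iy i; apply: dI (Iy i) => j; exact: xy.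
- by move=> x y Ix Iy i; exact: (uI _ _ (Ix i) (Iy i)).
- move=> N i; apply: dI (fI N) => j; rewrite /row.
  by apply: leq_ltn_trans; exact: (leq_to_nat i j).2.
Qed.

(** A rowwise choice of pseudo-unions can leave infinitely many rows with finitely
    many exceptional points each. Adding to row i the i-th rows of x_0, ..., x_i
    confines the exceptions for x_k to the finitely many rows i < k. *)
Lemma power_ideal_p I : ideal I -> p_ideal I -> p_ideal (power_ideal I).
Proof.
move=> [dI uI fI] pI x Ix.
have /choice[a aP] i : exists a, I a /\ forall k, almost_le (row (x k) i) a.
  by have [k|a Ia xa] := pI (fun k => row (x k) i); [exact: Ix | exists a].
pose y k i j := has (fun k' => row (x k') i j) (iota 0 k).
have Iy k i : I (y k i).
  elim: k => [|k IH]; first by apply: dI (fI 0) => j.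
  apply: dI (uI _ _ IH (Ix k i)) => j.
  by rewrite /y -addn1 iotaD has_cat /= orbF.
pose b m := let: (i, j) := Cantor.of_nat m in a i j || y i.+1 i j.
have rowb i j : row b i j = a i j || y i.+1 i j.
  by rewrite /row /b Cantor.cancel_of_to.
exists b => [i|k].
  by apply: dI (uI _ _ (aP i).1 (Iy i.+1 i)) => j; rewrite rowb.
have /choice[N NP] i := (aP i).2 k.
(* Only the rows i < k contain exceptions, and there they lie below N i. *)
pose M := \max_(i < k) \max_(j < N i) (Cantor.to_nat (val i, val j)).+1.
exists M => m; rewrite -(Cantor.cancel_to_of m).
case: (Cantor.of_nat m) => i j Mm xm; rewrite -/(row b i j) rowb.
have [ki|ik] := leqP k i.
  apply/orP; right; apply/hasP; exists k => //.
  by rewrite mem_iota /= add0n ltnS.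
apply/orP; left; apply: NP => //; rewrite leqNgt; apply/negP => jN.
move: Mm; apply/negP; rewrite -ltnNge.
apply: leq_trans (leq_bigmax (Ordinal ik)).
exact: (leq_bigmax (F := fun j : 'I__ => (Cantor.to_nat (i, val j)).+1) (Ordinal jN)).
Qed.

(** Intervals of codes starting at a fast growing sequence s are considered; the
    trace H k of the k-th one collects its columns in the rows i < k. The growth
    of s makes the traces pairwise disjoint, so the maximal ideal I contains the
    union of those with even index or of those with odd index. The union of the
    corresponding intervals is in the power ideal, because row i only meets
    finitely many of them outside the traces. *)
Lemma power_ideal_swallows I : maximal_ideal I -> swallows_intervals (power_ideal I).
Proof.
move=> [[dI uI fI] _ mI] f.
pose step n := maxn (maxn n.+1 (f n))
  (\max_(i < n.+1) \max_(j < maxn n (f n)) (Cantor.to_nat (val i, val j)).+1).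
have step_gt n : (n < step n)%N by rewrite /step !leq_max leqnn.
have step_f n : (f n <= step n)%N by rewrite /step !leq_max leqnn orbT.
have step_code n i j : (i <= n)%N -> (j < maxn n (f n))%N ->
    (Cantor.to_nat (i, j) < step n)%N.
  move=> i_n jn; rewrite /step leq_max; apply/orP; right.
  have i_n1 : (i < n.+1)%N by [].
  apply: leq_trans (leq_bigmax (Ordinal i_n1)).
  exact: (leq_bigmax (F := fun j : 'I__ => (Cantor.to_nat (i, val j)).+1) (Ordinal jn)).
pose s k := iter k step 0.
have sS k : s k.+1 = step (s k) by [].
have s_mono k l : (k <= l)%N -> (s k <= s l)%N.
  elim: l => [|l IH]; first by rewrite leqn0 => /eqP->.
  rewrite leq_eqVlt => /predU1P[->//|/IH kl].
  by rewrite sS (leq_trans kl) // ltnW.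
have s_ge k : (k <= s k)%N.
  by elim: k => // k IH; rewrite sS (leq_ltn_trans IH).
pose inside k i j := (s k <= Cantor.to_nat (i, j) < f (s k))%N.
have inside_lt k i j : inside k i j -> (j < f (s k))%N.
  by move=> /andP[_]; apply: leq_ltn_trans; exact: (leq_to_nat i j).2.
pose H k j := has (fun i => inside k i j) (iota 0 k).
have disj k l j : (k < l)%N -> H k j -> ~~ H l j.
  case: l => // l; rewrite ltnS => kl /hasP[i _ /inside_lt jk].
  apply/hasPn => i'; rewrite mem_iota /= add0n ltnS => i'l.
  rewrite /inside negb_and -ltnNge sS; apply/orP; left; apply: step_code.
    exact: leq_trans (s_ge l).
  rewrite leq_max; have [<-|ltkl] := eqVneq k l; first by rewrite jk orbT.
  apply/orP; left; apply: leq_trans jk _; apply: leq_trans (step_f _) _.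
  by rewrite -sS; apply: s_mono; rewrite ltn_neqAle ltkl.
pose C p j := `[< exists2 k, odd k = p & H k j >].
(* If the union of the odd traces is not in I, its complement is, and the
   complement contains all even traces. *)
have [p IC] : exists p, I (C p).
  have [IC|IC] := mI (C true); first by exists true.
  exists false; apply: dI IC => j /asboolP[k ek kj].
  apply/asboolP => -[l ol lj]; have [kl|lk|e] := ltngtP k l.
  - by have := disj _ _ _ kl kj; rewrite lj.
  - by have := disj _ _ _ lk lj; rewrite kj.
  - by move: ek; rewrite e ol.
pose b m := `[< exists2 k, odd k = p & (s k <= m < f (s k))%N >].
exists b => [i|N].
  apply: dI (uI _ _ IC (fI (s i.+1))) => j /asboolP[k kp jk].
  have [ik|ki] := ltnP i k.
    apply/orP; left; apply/asboolP; exists k => //.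
    by apply/hasP; exists i => //; rewrite mem_iota.
  apply/orP; right; apply: leq_trans (inside_lt k i j jk) _.
  by apply: leq_trans (step_f _) _; rewrite -sS; exact: s_mono.
pose k := (p + N.*2)%N.
exists (s k); first by apply: leq_trans (s_ge k); rewrite /k -addnn; lia.
by move=> m mk; apply/asboolP; exists k => //; rewrite /k oddD odd_double addbF oddb.
Qed.

(** * The topology of the power in terms of initial segments *)

Lemma agree_filter (T : Type) (phi : T -> nat -> bool) (p : T) :
  Filter [set A : set T | exists N, forall q, agree N (phi p) (phi q) -> A q].
Proof.
split; first by exists 0.
  move=> A B [M AM] [N BN]; exists (maxn M N) => q pq; split.
    by apply: AM; apply: agreeW pq; exact: leq_maxl.
  by apply: BN; apply: agreeW pq; exact: leq_maxr.
by move=> A B AB [N AN]; exists N => q /AN /AB.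
Qed.

Lemma open_cantor_agree (U : set cantor_space) (x : cantor_space) :
  open U -> U x -> exists N, forall y, agree N x y -> U y.
Proof.
move=> oU Ux.
pose F : set_system cantor_space := [set A | exists N, forall y, agree N x y -> A y].
have FF : Filter F := agree_filter id x.
have Fx : F --> x.
  apply/cvg_sup => i A [B [[C oC <-] Cx] BA]; exists i.+1 => y xy.
  by apply: BA; rewrite /= -xy.
by apply: Fx; exact: open_nbhs_nbhs.
Qed.

Section OmegaPower.
Variable I : set cantor_space.
Let Y := omega_power I.

Definition flatten (p : Y) (m : nat) : bool :=
  let: (i, j) := Cantor.of_nat m in (set_val (p i) : nat -> bool) j.

Lemma row_flatten p i : row (flatten p) i = set_val (p i).
Proof. by apply/funext => j; rewrite /row /flatten Cantor.cancel_of_to. Qed.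

Lemma flatten_power p : power_ideal I (flatten p).
Proof. by move=> i; rewrite row_flatten; exact: set_valP. Qed.

Definition unflatten (z : nat -> bool) (Iz : power_ideal I z) : Y :=
  fun i => exist _ (row z i) (mem_set (Iz i)).

Lemma unflattenK z (Iz : power_ideal I z) : flatten (unflatten Iz) = z.
Proof.
apply/funext => m; rewrite /flatten -[in RHS](Cantor.cancel_to_of m).
by case: (Cantor.of_nat m).
Qed.

Lemma flatten_inj p q : flatten p = flatten q -> p = q.
Proof.
move=> pq; apply: functional_extensionality_dep => i; apply: val_inj.
by have := row_flatten p i; rewrite pq row_flatten.
Qed.

Lemma nbhs_flatten (p : Y) (A : set Y) : nbhs p A ->
  exists N, forall q, agree N (flatten p) (flatten q) -> A q.
Proof.
pose F : set_system Y := [set A | exists N, forall q, agree N (flatten p) (flatten q) -> A q].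
have FF : Filter F := agree_filter flatten p.
suff Fp : F --> p by move=> /Fp.
apply/cvg_sup => i B [C [[V [U oU <-] <-] Upi] CB].
have [N UN] := open_cantor_agree oU Upi.
exists (\max_(j < N) (Cantor.to_nat (i, val j)).+1) => q pq.
apply: CB => /=; apply: UN => j jN.
rewrite -!row_flatten /row; apply: pq.
exact: (leq_bigmax (F := fun j : 'I__ => (Cantor.to_nat (i, val j)).+1) (Ordinal jN)).
Qed.

Lemma nbhs_agree (p : Y) N : nbhs p [set q | agree N (flatten p) (flatten q)].
Proof.
have coord m : nbhs p [set q | flatten p m = flatten q m].
  rewrite /flatten; case: (Cantor.of_nat m) => i j.
  have cantor_coord (x : cantor_space) : nbhs x [set y : cantor_space | x j = y j].
    apply: (@proj_continuous nat (fun=> bool) j x [set b | x j = b]).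
    by rewrite nbhs_principalE; apply/principal_filterP.
  apply: (@proj_continuous nat (fun=> set_type I) i p
    [set a | (set_val (p i) : nat -> bool) j = (set_val a : nat -> bool) j]).
  exact: (@initial_continuous _ _ (@set_val _ I) (p i) _ (cantor_coord _)).
elim: N => [|N IH]; first by apply: filterS filterT => q.
by apply: filterS2 IH (coord N) => q pq pqN; apply/agreeS.
Qed.

Lemma flatten_continuous (f : Y -> Y) :
  (forall N p q, agree N (flatten p) (flatten q) ->
     agree N (flatten (f p)) (flatten (f q))) -> continuous f.
Proof.
move=> fL p A /nbhs_flatten[N AN]; rewrite /nbhs /=.
by apply: filterS (nbhs_agree p N) => q /fL /AN.
Qed.

Lemma dense_flatten (D : set Y) : ideal I -> dense D ->
  forall N t, exists2 d, (flatten @` D) d & agree N d t.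
Proof.
move=> idI dD N t.
have It : power_ideal I (truncate N t) := ideal_truncate N t (power_ideal_ideal idI).
have [|q [/interior_subset qN Dq]] := dD
    ([set q | agree N (flatten (unflatten It)) (flatten q)])^°
    _ (@open_interior _ _).
  by exists (unflatten It); exact: nbhs_agree.
exists (flatten q); first by exists q.
apply: agree_trans (agree_sym qN) _; rewrite unflattenK; exact: agree_truncate.
Qed.

End OmegaPower.

(** The isometry h produced by the matching maps x into the union of x and A for a
    member A of the power ideal, hence preserves it; so does its inverse. *)
Theorem omega_power_cdh (I : set cantor_space) : ideal I ->
  p_ideal (power_ideal I) -> swallows_intervals (power_ideal I) ->
  countable_dense_homogeneous (omega_power I).
Proof.
move=> idI pJ sJ D E cD dD cE dE.
have idJ := power_ideal_ideal idI; have [dJ uJ _] := idJ.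
pose flatI := @flatten I.
have [||||||A [JA DA EA]] := @dense_modulo_exists _ (flatI @` D) (flatI @` E) idJ pJ sJ.
- exact: card_le_trans (card_image_le _ _) cD.
- exact: card_le_trans (card_image_le _ _) cE.
- by move=> _ [p _ <-]; exact: flatten_power.
- by move=> _ [p _ <-]; exact: flatten_power.
- exact: dense_flatten.
- exact: dense_flatten.
have [||h [g [hK gK [hL gL] [hA gA] [hDE gED]]]] := isometry_matching _ _ DA EA.
- exact: card_le_trans (card_image_le _ _) cD.
- exact: card_le_trans (card_image_le _ _) cE.
have stable k : (forall x n, ~~ A n -> k x n = x n) ->
    forall p, power_ideal I (k (flatI p)).
  move=> kA p; apply: dJ (uJ _ _ (flatten_power p) JA) => n.
  by have [_|nA] := boolP (A n); [rewrite orbT | rewrite kA // orbF].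
pose f p := unflatten (stable h hA p); pose f' p := unflatten (stable g gA p).
have flatf p : flatI (f p) = h (flatI p) by exact: unflattenK.
have flatf' p : flatI (f' p) = g (flatI p) by exact: unflattenK.
exists f.
  split; first by apply: flatten_continuous => N p q pq; rewrite -!/flatI !flatf; exact: hL.
  exists f'; split.
  - by apply: flatten_continuous => N p q pq; rewrite -!/flatI !flatf'; exact: gL.
  - by move=> p; apply: flatten_inj; rewrite -/flatI flatf' flatf hK.
  - by move=> p; apply: flatten_inj; rewrite -/flatI flatf flatf' gK.
apply/seteqP; split=> [_ [p Dp <-]|q Eq].
  have [q Eq qh] : (flatI @` E) (h (flatI p)) by apply: hDE; exists p.
  by rewrite (_ : f p = q) //; apply: flatten_inj; rewrite -/flatI flatf.
have [p Dp pg] : (flatI @` D) (g (flatI q)) by apply: gED; exists q.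
by exists p => //; apply: flatten_inj; rewrite -/flatI flatf pg gK.
Qed.

(** * Maximal ideals are not G-delta *)

(** A direct Baire category construction: a set y is built by finite
    approximations so that both y and its complement enter every open set of the
    family. Each step first extends by an element of I that is empty from some
    point on, and then by the complement of such an element. *)
Lemma maximal_ideal_not_Gdelta (I : set cantor_space) : maximal_ideal I -> ~ Gdelta I.
Proof.
move=> [idI nI _] [F oF IF]; have [dI uI _] := idI.
have IsubF k x : I x -> F k x by rewrite IF => /(_ k Logic.I).
pose neg (x : nat -> bool) n := ~~ x n.
have neg_agree n x y : agree n (neg x) y -> agree n x (neg y).
  by move=> xy m mn; rewrite /neg -xy // /neg negbK.
have /choice[next nextP] (kNx : nat * (nat * (nat -> bool))) : exists Nx,
    [/\ (kNx.2.1 < Nx.1)%N, agree kNx.2.1 kNx.2.2 Nx.2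
      & forall y, agree Nx.1 Nx.2 y -> F kNx.1 y /\ F kNx.1 (neg y)].
  case: kNx => k [N x] /=.
  have [M1 M1P] := open_cantor_agree (oF k) (IsubF k _ (ideal_truncate N x idI)).
  pose N1 := maxn N M1; pose w := truncate N1 (neg (truncate N x)).
  have [M2 M2P] := open_cantor_agree (oF k) (IsubF k _ (ideal_truncate N1 _ idI) : F k w).
  have xw : agree N1 (truncate N x) (neg w) by apply/neg_agree/agree_sym/agree_truncate.
  exists ((maxn N1 M2).+1, neg w); split=> /=.
  - by rewrite ltnS !leq_max leqnn.
  - apply: agree_trans (agree_sym (@agree_truncate N x)) (agreeW _ xw).
    exact: leq_maxl.
  - move=> y wy; split.
      apply/M1P/(agreeW (leq_maxr N M1)); apply: agree_trans xw (agreeW _ wy).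
      by rewrite ltnW // ltnS leq_maxl.
    apply/M2P/neg_agree; apply: agreeW wy.
    by rewrite ltnW // ltnS leq_maxr.
pose s := fix s k := if k is k'.+1 then next (k', s k') else (0, xpred0).
have sS k : s k.+1 = next (k, s k) by [].
have s_mono k l : (k <= l)%N ->
    ((s k).1 <= (s l).1)%N /\ agree (s k).1 (s k).2 (s l).2.
  elim: l => [|l IH]; first by rewrite leqn0 => /eqP->.
  rewrite leq_eqVlt => /predU1P[->//|/IH[kl xkl]].
  have [/= /ltnW ll xll _] := nextP (l, s l); split.
    exact: leq_trans ll.
  exact: agree_trans xkl (agreeW kl xll).
have s_ge k : (k <= (s k).1)%N.
  elim: k => // k IH; rewrite sS; apply: leq_ltn_trans IH _.
  by have [] := nextP (k, s k).
pose y n := (s n.+1).2 n.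
have sy k : agree (s k).1 (s k).2 y.
  move=> m mk; have [_ ->//] := s_mono _ _ (leq_maxl k m.+1).
  by have [_ <-//] := s_mono _ _ (leq_maxr k m.+1); exact: s_ge m.+1.
have Fy k : F k y /\ F k (neg y).
  by have [_ _ H] := nextP (k, s k); apply: H; rewrite -sS.
apply: nI; apply: dI (uI y (neg y) _ _) => [n _||].
- exact: orbN.
- by rewrite IF => k _; have [] := Fy k.
- by rewrite IF => k _; have [] := Fy k.
Qed.

(** * Cardinality of the set of finite words *)
Lemma graph_card_le T U (A : set T) (B : set U) (G : T -> U -> Prop) :
  (forall a, A a -> exists2 b, B b & G a b) ->
  (forall a a' b, A a -> A a' -> G a b -> G a' b -> a = a') -> A #<= B.
Proof.
move=> AB Ginj; apply/card_leP.
have /choice[f fP] (a : set_type A) : exists b : set_type B, G (set_val a) (set_val b).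
  have [b Bb ab] := AB _ (set_valP a).
  by exists (exist _ b (mem_set Bb)).
apply: injfunPex.2; exists f => //= a a' _ _ faa'; apply: val_inj.
apply: (Ginj _ _ (set_val (f a))); [exact: set_valP | exact: set_valP | exact: fP |].
by rewrite faa'; exact: fP.
Qed.

Lemma fun_card_le T U (A : set T) (B : set U) (f : T -> U) :
  (forall a, A a -> B (f a)) ->
  (forall a a', A a -> A a' -> f a = f a' -> a = a') -> A #<= B.
Proof.
move=> fAB finj; apply: (@graph_card_le _ _ _ _ (fun a b => f a = b)).
  by move=> a Aa; exists (f a) => //; exact: fAB.
by move=> a a' b Aa Aa' <- /esym; exact: finj.
Qed.

Lemma card_le_fun T (U : pointedType) (A : set T) (B : set U) : A #<= B ->
  exists f : T -> U, (forall a, A a -> B (f a)) /\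
    forall a a', A a -> A a' -> f a = f a' -> a = a'.
Proof.
move=> /pcard_leP/injfunPex[f fAB finj]; exists f; split=> // a a' Aa Aa'.
by apply: finj; rewrite inE.
Qed.

Lemma chain_bigcup2 T (F : set (set T)) p q : total_on F subset ->
  (\bigcup_(X in F) X) p -> (\bigcup_(X in F) X) q ->
  exists X, [/\ F X, X p & X q].
Proof.
move=> Ftot [X FX Xp] [Y FY Yq]; have [XY|YX] := Ftot _ _ FX FY.
  by exists Y; split=> //; exact: XY.
by exists X; split=> //; exact: YX.
Qed.

(** Zorn's lemma on partial injections between A and B. *)
Lemma card_le_total T U (A : set T) (B : set U) : A #<= B \/ B #<= A.
Proof.
pose P (G : set (T * U)) := [/\ G `<=` A `*` B,
  forall a b b', G (a, b) -> G (a, b') -> b = b' &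
  forall a a' b, G (a, b) -> G (a', b) -> a = a'].
have [F FP Ftot|G [[GAB Gfun Ginj] Gmax]] := @Zorn_bigcup _ P.
  split.
  - by move=> p [X FX Xp]; have [XAB _ _] := FP _ FX; exact: XAB.
  - move=> a b b' Gab Gab'; have [X [FX Xab Xab']] := chain_bigcup2 Ftot Gab Gab'.
    by have [_ H _] := FP _ FX; exact: H Xab Xab'.
  - move=> a a' b Gab Gab'; have [X [FX Xab Xab']] := chain_bigcup2 Ftot Gab Gab'.
    by have [_ _ H] := FP _ FX; exact: H Xab Xab'.
have [AG|/existsNP[a /not_implyP[Aa aG]]] := pselect (forall a, A a -> exists b, G (a, b)).
  left; apply: (@graph_card_le _ _ _ _ (fun a b => G (a, b))) => [a /AG[b ab]|].
    by exists b => //; have [] := GAB _ ab.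
  by move=> a a' b _ _; exact: Ginj.
right; apply: (@graph_card_le _ _ _ _ (fun b a => G (a, b))) => [b Bb|b b' x _ _]; last first.
  exact: Gfun.
have [[x xb]|bG] := pselect (exists x, G (x, b)).
  by exists x => //; have [] := GAB _ xb.
exfalso; apply: (Gmax (G `|` [set (a, b)])).
  split; first by move=> p Gp; left.
  by move=> GG; apply: aG; exists b; apply: GG; right.
split.
- by move=> p [/GAB//|->].
- move=> x y y' [xy|[-> ->]] [xy'|[]].
  + exact: Gfun xy xy'.
  + by move=> xa _; case: aG; exists y; rewrite -xa.
  + by case: aG; exists y'.
  + by [].
- move=> x x' y [xy|[-> ->]] [xy'|[]].
  + exact: Ginj xy xy'.
  + by move=> _ yb; case: bG; exists x; rewrite -yb.
  + by case: bG; exists x'.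
  + by [].
Qed.

Definition words (T : eqType) (W : set T) : set (seq T) :=
  [set s | forall x, x \in s -> W x].

Lemma words_cons (T : eqType) (W : set T) x s : words W (x :: s) <-> W x /\ words W s.
Proof.
split=> [Wxs|[Wx Ws] y]; last by rewrite inE => /predU1P[->|/Ws].
by split=> [|y ys]; apply: Wxs; rewrite inE ?eqxx ?ys ?orbT.
Qed.

Lemma words_map (T U : eqType) (W : set T) (V : set U) (f : T -> U) s :
  (forall x, W x -> V (f x)) -> words W s -> words V (map f s).
Proof. by move=> WV Ws _ /mapP[x /Ws Wx ->]; exact: WV. Qed.

Lemma map_inj_words (T : eqType) U (W : set T) (f : T -> U) s t :
  (forall x y, W x -> W y -> f x = f y -> x = y) ->
  words W s -> words W t -> map f s = map f t -> s = t.
Proof.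
move=> finj; elim: s t => [|x s IH] [|y t] //.
by move=> /words_cons[Wx Ws] /words_cons[Wy Wt] [/finj-> // /IH->].
Qed.

(** Zorn's lemma on the graphs G of injections from the nonempty words over a
    subset B of W into B. Let B belong to a maximal such graph. If W minus B injects
    into B, then W injects into B, because an element of W can be sent to the
    code of a word of length one or two over B; so words over W inject into B.
    Otherwise B injects into W minus B, with image C say, and the same
    coding sends words over the union of B and C into C, which extends G. Words are
    taken nonempty so that the empty graph qualifies as the union of the empty
    chain. *)
Lemma card_words (T : pointedType) (W : set T) : infinite_set W -> words W #<= W.
Proof.
move=> infW.
pose B (G : set (seq T * T)) := [set b | exists v, G ([:: b], v)].
pose P (G : set (seq T * T)) := [/\
  forall l v v', G (l, v) -> G (l, v') -> v = v',
  forall l l' v, G (l, v) -> G (l', v) -> l = l',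
  forall l v, G (l, v) -> [/\ l <> [::], words (B G) l & B G v],
  forall l, l <> [::] -> words (B G) l -> exists v, G (l, v)
  & B G `<=` W].
have [F FP Ftot|G [[Gfun Ginj Gdom Gtot GW] Gmax]] := @Zorn_bigcup _ P.
  have BU X : F X -> B X `<=` B (\bigcup_(X in F) X).
    by move=> FX b [v Xbv]; exists v, X.
  split.
  - move=> l v v' lv lv'; have [X [FX Xlv Xlv']] := chain_bigcup2 Ftot lv lv'.
    by have [H _ _ _ _] := FP _ FX; exact: H Xlv Xlv'.
  - move=> l l' v lv lv'; have [X [FX Xlv Xlv']] := chain_bigcup2 Ftot lv lv'.
    by have [_ H _ _ _] := FP _ FX; exact: H Xlv Xlv'.
  - move=> l v [X FX Xlv]; have [_ _ /(_ _ _ Xlv)[l0 lB vB] _ _] := FP _ FX.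
    by split=> // [x /lB|]; exact: (BU X FX).
  - move=> l l0 lB; suff [X FX XB] : exists2 X, F X & words (B X) l.
      by have [_ _ _ /(_ _ l0 XB)[v Xlv] _] := FP _ FX; exists v, X.
    elim: l l0 lB => // x [|y l] IH _ /words_cons[[v [X FX Xxv]] lB].
      by exists X => //; apply/words_cons; split=> //; exists v.
    have [//|Y FY YB] := IH _ lB.
    have [XY|YX] := Ftot _ _ FX FY.
      exists Y => //; apply/words_cons; split=> //.
      by exists v; exact: XY.
    exists X => //; apply/words_cons; split; first by exists v.
    by move=> z /YB[w Yzw]; exists w; exact: YX.
  - by move=> b [v [X FX Xbv]]; have [_ _ _ _] := FP _ FX; apply; exists v.
have no_extension (C : set T) (psi : seq T -> T) :
    C !=set0 -> C `<=` W `\` B G ->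
    (forall l, l <> [::] -> words (B G `|` C) l -> C (psi l)) ->
    (forall l l', words (B G `|` C) l -> words (B G `|` C) l' ->
       psi l = psi l' -> l = l') -> False.
  move=> [c Cc] CW psiC psiI.
  pose G' := G `|` [set lv | [/\ lv.1 <> [::], words (B G `|` C) lv.1,
    ~ words (B G) lv.1 & lv.2 = psi lv.1]].
  have nB x s : C x -> ~ words (B G) (x :: s) by move=> /CW[_ nBx] /words_cons[].
  have BG' : B G' = B G `|` C.
    apply/seteqP; split=> [b [v [Gbv|[/= _ /words_cons[bBC _] _ _]]]|b [[v Gbv]|Cb]].
    - by left; exists v.
    - by [].
    - by exists v; left.
    - exists (psi [:: b]); right; split=> //=; last exact: nB.
      by apply/words_cons; split=> //; right.
  have Cnew l v : G (l, v) -> C v -> False.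
    by move=> /Gdom[_ _ Bv] /CW[].
  apply: (Gmax G').
    split; first by move=> p; left.
    move=> G'G; have /Gdom[_ ] : G ([:: c], psi [:: c]).
      apply: G'G; right; split=> //=; last exact: nB.
      by apply/words_cons; split=> //; right.
    by move=> cB _; exact: nB cB.
  rewrite /P BG'; split.
  - move=> l v v' [lv|[/= l0 lBC lB ->]] [lv'|[/= _ _ lB' ->]] //.
    + exact: Gfun lv lv'.
    + by have [_ /lB'] := Gdom _ _ lv.
    + by have [_ /lB] := Gdom _ _ lv'.
  - move=> l l' v [lv|[/= l0 lBC lB ev]] [lv'|[/= l0' lBC' lB' ev']].
    + exact: Ginj lv lv'.
    + by case: (Cnew _ _ lv); rewrite ev'; exact: psiC.
    + by case: (Cnew _ _ lv'); rewrite ev; exact: psiC.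
    + by apply: psiI => //; rewrite -ev.
  - move=> l v [/Gdom[l0 lB Bv]|[/= l0 lBC _ ->]]; split=> //.
    + by move=> x /lB; left.
    + by left.
    + by right; exact: psiC.
  - move=> l l0 lBC; have [lB|nlB] := pselect (words (B G) l).
      by have [v lv] := Gtot l l0 lB; exists v; left.
    by exists (psi l); right.
  - by move=> x [/GW|/CW[]].
have [f fP] : exists f : seq T -> T, forall l, l <> [::] -> words (B G) l -> G (l, f l).
  have /choice[f fP] l : exists v, l <> [::] -> words (B G) l -> G (l, v).
    have [[v lv]|nv] := pselect (exists v, G (l, v)); first by exists v.
    by exists point => l0 lB; case: nv; exact: Gtot.
  by exists f.
have fB l : l <> [::] -> words (B G) l -> B G (f l).
  by move=> l0 lB; have [] := Gdom _ _ (fP l l0 lB).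
have fI l l' : l <> [::] -> l' <> [::] -> words (B G) l -> words (B G) l' ->
    f l = f l' -> l = l'.
  move=> l0 l0' lB lB' ff; apply: (Ginj _ _ (f l)); first exact: fP.
  by rewrite ff; exact: fP.
have fconsI x l y l' : words (B G) (x :: l) -> words (B G) (y :: l') ->
    f (x :: l) = f (y :: l') -> x :: l = y :: l' by exact: fI.
have pairB x y : B G x -> B G y -> words (B G) [:: x; y].
  by move=> Bx By; do ![apply/words_cons; split].
have oneB x : B G x -> words (B G) [:: x].
  by move=> Bx; apply/words_cons.
(* If B is empty, a countably infinite subset of W gives a larger graph. *)
have [[b Bb]|B0] := pselect (B G !=set0); last first.
  have [i [iW iI]] := card_le_fun ((infiniteP W).1 infW).
  pose inv x := xget 0 [set n | i n = x].
  have iK n : inv (i n) = n.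
    by rewrite /inv; case: xgetP => [m _ /iI->//|/(_ n)/=[]].
  have BC : B G `|` range i = range i.
    by apply/setUidr => x Bx; case: B0; exists x.
  exfalso; apply: (no_extension (range i) (fun l => i (pickle (map inv l)))).
  - by exists (i 0), 0.
  - move=> _ [n _ <-]; split; first exact: iW.
    by move=> Bin; apply: B0; exists (i n).
  - by move=> l _ _; exists (pickle (map inv l)).
  - move=> l l'; rewrite BC => lC lC' /(iI _ _ Logic.I Logic.I)/(pcan_inj pickleK) ll.
    apply: (map_inj_words _ lC lC'); last exact: ll.
    by move=> _ _ [n _ <-] [m _ <-]; rewrite !iK => ->.
(* The letters in B become words of length one and the others, sent into B by k,
   words of length two; the leading letter b keeps the coded word nonempty. *)
have coding (V : set T) (k : T -> T) :
    (forall x, V x -> ~ B G x -> B G (k x)) ->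
    (forall x y, V x -> ~ B G x -> V y -> ~ B G y -> k x = k y -> x = y) ->
    exists code : seq T -> T, (forall l, words V l -> B G (code l)) /\
      forall l l', words V l -> words V l' -> code l = code l' -> l = l'.
  move=> kB kI.
  pose h x := if pselect (B G x) then f [:: x] else f [:: k x; k x].
  have hB x : V x -> B G (h x).
    rewrite /h; case: pselect => [Bx _|nBx Vx]; apply: fB => //; first exact: oneB.
    by apply: pairB; exact: kB.
  have hI x y : V x -> V y -> h x = h y -> x = y.
    rewrite /h; case: pselect => Bx Vx; case: pselect => By Vy fxy.
    - by have [] := fconsI _ _ _ _ (oneB _ Bx) (oneB _ By) fxy.
    - by have := fconsI _ _ _ _ (oneB _ Bx) (pairB _ _ (kB _ Vy By) (kB _ Vy By)) fxy.
    - by have := fconsI _ _ _ _ (pairB _ _ (kB _ Vx Bx) (kB _ Vx Bx)) (oneB _ By) fxy.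
    - have [] := fconsI _ _ _ _ (pairB _ _ (kB _ Vx Bx) (kB _ Vx Bx))
        (pairB _ _ (kB _ Vy By) (kB _ Vy By)) fxy.
      by move=> kxy _; exact: kI kxy.
  have bhB l : words V l -> words (B G) (b :: map h l).
    by move=> lV; apply/words_cons; split=> //; exact: words_map lV.
  exists (fun l => f (b :: map h l)); split=> [l lV|l l' lV lV' ff].
    by apply: fB => //; exact: bhB.
  by have [/(map_inj_words hI lV lV')] := fconsI _ _ _ _ (bhB _ lV) (bhB _ lV') ff.
have [/card_le_fun[k [kB kI]]|/card_le_fun[e [eW eI]]] := card_le_total (W `\` B G) (B G).
  have [||code [codeB codeI]] := @coding W k.
  - by move=> x Wx nBx; exact: kB.
  - by move=> x y Wx nBx Wy nBy; exact: kI.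
  by apply: (@fun_card_le _ _ _ _ code) => // l /codeB/GW.
pose inv x := xget point [set y | B G y /\ e y = x].
have eK y : B G y -> inv (e y) = y.
  move=> By; rewrite /inv; case: xgetP => [z _ [Bz]|/(_ y)/=[]//].
  exact: eI.
pose C := e @` B G.
have invP x : (B G `|` C) x -> ~ B G x -> B G (inv x) /\ e (inv x) = x.
  by move=> [//|[y By <-]] _; rewrite eK.
have [||code [codeB codeI]] := @coding (B G `|` C) inv.
- by move=> x Vx nBx; have [] := invP x Vx nBx.
- move=> x y Vx nBx Vy nBy xy.
  by have [_ <-] := invP x Vx nBx; have [_ <-] := invP y Vy nBy; rewrite xy.
exfalso; apply: (no_extension C (e \o code)).
- by exists (e b), b.
- by move=> _ [y By <-]; exact: eW.
- by move=> l _ /codeB Bl; exists (code l).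
- move=> l l' lV lV' /eI ll; apply: codeI => //.
  by apply: ll; exact: codeB.
Qed.

Lemma cantor_diagonal : ~ ([set: nat -> bool] #<= [set: nat]).
Proof.
move=> /card_le_fun[f [_ fI]].
pose d n := ~~ (xget xpred0 [set x | f x = n]) n.
have : d (f d) = ~~ d (f d).
  rewrite {1}/d; case: xgetP => [x _ /fI->//|/(_ d)/=[]//].
by case: (d (f d)).
Qed.

Lemma card_words_continuum (T : pointedType) (W : set T) :
  ~ ([set: nat -> bool] #<= W) ->
  ~ ([set: nat -> bool] #<= words W `*` [set: nat]).
Proof.
move=> cW cL; have [/finite_set_countable/countable_injP[f fI]|infW] := pselect (finite_set W).
  apply: cantor_diagonal; apply: (card_le_trans cL).
  apply: (@fun_card_le _ _ _ _ (fun ln => pickle (map f ln.1, ln.2))) => //.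
  move=> [l n] [l' n'] [/= lW _] [/= lW' _] /(pcan_inj pickleK)[+ ->].
  move=> /(map_inj_words _ lW lW')-> //.
  by move=> x y Wx Wy; apply: fI; rewrite inE.
apply: cW; apply: (card_le_trans cL); apply: card_le_trans (card_words infW).
have [i [iW iI]] := card_le_fun ((infiniteP W).1 infW).
apply: (@fun_card_le _ _ _ _ (fun ln => i ln.2 :: ln.1)).
  by move=> [l n] [/= lW _]; apply/words_cons; split=> //; exact: iW.
by move=> [l n] [l' n'] _ _ /= [/iI-> // ->].
Qed.

(** * Generic sequences and pseudo-unions *)

(** A separate name for finite sequences, to carry the order by reverse extension. *)
Definition cohen := seq nat.
HB.instance Definition _ := Choice.on cohen.

Definition cohen_le (p q : cohen) := prefix (q : seq nat) p.

Lemma cohen_refl : reflexive cohen_le. Proof. exact: prefix_refl. Qed.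

Lemma cohen_anti : antisymmetric cohen_le.
Proof.
move=> p q /andP[/prefixP[s ps] /prefixP[t qt]].
have := congr1 size ps; rewrite qt !size_cat => e.
by move: qt; case: t e => [_|x t /= ]; [rewrite cats0 | lia].
Qed.

Lemma cohen_trans : transitive cohen_le.
Proof. by move=> q p r qp rq; exact: prefix_trans rq qp. Qed.

Fact cohen_display : Order.disp_t. Proof. exact: Order.Disp tt tt. Qed.

HB.instance Definition _ := Order.Le_isPOrder.Build cohen_display cohen
  cohen_refl cohen_anti cohen_trans.

Lemma cohen_leP (p q : cohen) : (p <= q)%O <-> exists s, p = q ++ s.
Proof. by split=> [/prefixP//|/prefixP]. Qed.

(** Each strategy phi l is followed at least once by g: the finite sequences that
    already follow it somewhere form a dense set, as any sequence can be
    prolonged by the answer of phi l. *)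
Lemma cohen_generic (L : Type) (S : set L) (phi : L -> seq nat -> nat) :
  MA_countable -> ~ ([set: nat -> bool] #<= S) ->
  exists g : nat -> nat, forall l, S l -> exists k, g k = phi l (mkseq g k).
Proof.
move=> MA cS.
pose D (l : L) : set cohen :=
  [set p | exists2 k, (k < size p)%N & nth 0 p k = phi l (take k p)].
have [| | | |G [G0 Gup Gdir] GD] := MA cohen_display cohen _ _ (D @` S).
- by exists ([::] : cohen).
- exact: (@countableP (seq nat)).
- move=> _ [l _ <-] p; exists (rcons p (phi l p)); last first.
    by apply/cohen_leP; exists [:: phi l p]; rewrite cats1.
  exists (size p); first by rewrite size_rcons.
  by rewrite nth_rcons ltnn eqxx -cats1 take_size_cat.
- have DS := card_image_le D S; split; last by move=> cD; exact/cS/(card_le_trans cD).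
  apply: card_le_trans DS _; by case: (card_le_total S [set: nat -> bool]).
have Gnth p q i : G p -> G q -> (i < size p)%N -> (i < size q)%N ->
    nth 0 p i = nth 0 q i.
  move=> Gp Gq ip iq; have [r [_ /cohen_leP[s rs] /cohen_leP[t rt]]] := Gdir _ _ Gp Gq.
  have := congr1 (fun r => nth 0 r i) rs; rewrite {1}rt !nth_cat ip iq.
  by move=> ->.
pose g n := nth 0 (xget [::] [set p | G p /\ (n < size p)%N]) n.
have gP p i : G p -> (i < size p)%N -> g i = nth 0 p i.
  move=> Gp ip; rewrite /g; case: xgetP => [q _ [Gq iq]|/(_ p)[]//].
  exact: Gnth.
exists g => l Sl; have [p [Gp [k kp pk]]] := GD (D l) (imageP D Sl).
exists k; rewrite (gP p) // pk; congr (phi l).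
apply: (@eq_from_nth _ 0); first by rewrite size_mkseq size_take kp.
move=> i; rewrite size_take kp => ik.
by rewrite nth_take // nth_mkseq // (gP p) // (ltn_trans ik).
Qed.

(** The condition for S and the finite sets to generate a proper ideal. *)
Definition noncovering (S : set (nat -> bool)) := forall l, words S l ->
  forall m, exists2 n, (m <= n)%N & forall y, y \in l -> ~~ y n.

(** The pseudo-union a keeps from x_k the points that are at least g 0, ..., g k.
    To leave uncovered a point n beyond m, it suffices that n lies outside finitely
    many members of S and outside x_0, ..., x_(k-1), and that g k exceeds n: such
    a point is removed from all the later terms. Genericity of g provides this
    for every finite union of members of S. *)
Lemma pseudo_union_exists (S : set (nat -> bool)) (x : nat -> nat -> bool) :
  MA_countable -> ~ ([set: nat -> bool] #<= S) -> noncovering (S `|` range x) ->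
  exists a, (forall k, almost_le (x k) a) /\ noncovering (S `|` [set a]).
Proof.
move=> MA cS Sx.
have escape (lm : seq (nat -> bool) * nat) k : exists n, words S lm.1 ->
    [/\ (lm.2 <= n)%N, forall y, y \in lm.1 -> ~~ y n
      & forall i, (i < k)%N -> ~~ x i n].
  have [lS|nlS] := pselect (words S lm.1); last by exists 0.
  have [|n mn nl] := Sx (lm.1 ++ mkseq x k) _ lm.2.
    move=> y; rewrite mem_cat => /orP[/lS|/mapP[i _ ->]]; first by left.
    by right; exists i.
  exists n => _; split=> // [y yl|i ik]; apply: nl; rewrite mem_cat.
    by rewrite yl.
  by rewrite map_f ?orbT // mem_iota.
have [phi phiP] := choice (fun p : (seq (nat -> bool) * nat) * nat => escape p.1 p.2).
have [g gP] := cohen_generic (fun lm s => (phi (lm, size s)).+1) MA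
  (card_words_continuum cS).
pose a n := `[< exists2 k, x k n & forall i, (i <= k)%N -> (g i <= n)%N >].
exists a; split=> [k|l lSa m].
  exists (\max_(i < k.+1) g i) => n gn xkn; apply/asboolP; exists k => // i ik.
  have ik1 : (i < k.+1)%N by [].
  exact: leq_trans (leq_bigmax (Ordinal ik1)) gn.
pose l' := [seq y <- l | y != a].
have lS : words S l'.
  by move=> y; rewrite mem_filter => /andP[/eqP ya /lSa[|]].
have [k] := gP (l', m) (conj lS Logic.I); rewrite size_mkseq => gk.
have /= [mn nl nx] := phiP ((l', m), k) lS.
exists (phi (l', m, k)) => // y yl; have [->|ya] := eqVneq y a; last first.
  by apply: nl; rewrite mem_filter ya.
apply/asboolP => -[j xj gj]; have [jk|kj] := ltnP j k.
  by have := nx j jk; rewrite xj.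
by have := gj k kj; rewrite gk ltnn.
Qed.

(** * A maximal P-ideal *)

(** Well-order T. If some initial segment has the cardinality of T, the least
    such segment does and all its own initial segments are smaller. *)
Lemma short_well_order (T : pointedType) :
  exists (lt : T -> T -> Prop) (f : T -> T),
    [/\ well_founded lt, forall a b, [\/ lt a b, a = b | lt b a],
        forall a b c, lt a b -> lt b c -> lt a c, injective f
      & forall t, ~ ([set: T] #<= [set b | lt b (f t)])].
Proof.
have [R Rwo] := well_ordering_principle T.
have Rmin (P : set T) : P !=set0 -> exists2 z, P z & forall y, P y -> R z y.
  move=> [p Pp]; have [|z [[/asboolP Pz zmin] _]] := Rwo [pred x | `[< P x >]].
    by exists p; apply/asboolP.
  by exists z => // y Py; apply: zmin; apply/asboolP.
have Rrefl x : R x x by have [|z -> /(_ x)] := Rmin [set x]; [exists x | apply].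
have Ranti x y : R x y -> R y x -> x = y.
  move=> xy yx; have [|z [_ zuniq]] := Rwo [pred z | (z == x) || (z == y)].
    by exists x; rewrite inE eqxx.
  rewrite -(zuniq x) ?(zuniq y) //; split; rewrite ?inE ?eqxx ?orbT // => z' /orP[] /eqP->//.
pose lt a b := R a b /\ a <> b.
have ltNge a b : R b a -> ~ lt a b by move=> ba [ab]; apply; exact: Ranti.
have ltwf : well_founded lt.
  move=> a; apply: contrapT => na.
  have [|z nz zmin] := Rmin [set a | ~ Acc lt a]; first by exists a.
  apply: nz; constructor=> y yz; apply: contrapT => /zmin zy.
  exact: ltNge yz.
have lt_total a b : [\/ lt a b, a = b | lt b a].
  have [->|/eqP ab] := eqVneq a b; first by constructor 2.
  have [|z zab zmin] := Rmin [set a; b]; first by exists a; left.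
  case: zab zmin => -> zmin; [constructor 1 | constructor 3]; split=> //.
  - by apply: zmin; right.
  - by apply: zmin; left.
  - by move=> ba; apply: ab.
have lt_trans a b c : lt a b -> lt b c -> lt a c.
  move=> [ab nab] [bc nbc]; split; last first.
    by move=> ac; apply: nab; apply: Ranti => //; rewrite ac.
  have [|z zabc zmin] := Rmin [set a; b; c]; first by exists a; left; left.
  have [za zb zc] : [/\ R z a, R z b & R z c].
    by split; apply: zmin; [left; left | left; right | right].
  case: zabc => [[|]|] ez; rewrite ez in za zb zc => //.
  - by rewrite (Ranti _ _ ab za).
  - by rewrite -(Ranti _ _ bc zb).
exists lt; have [all_short|/existsNP[b nb]] :=
    pselect (forall b, ~ ([set: T] #<= [set a | lt a b])).
  by exists id; split.
have [|z /contrapT Tz zmin] := Rmin [set b | ~ ~ ([set: T] #<= [set a | lt a b])].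
  by exists b.
have [f [fz fI]] := card_le_fun Tz.
exists f; split=> // [x y|t ft]; first exact: fI.
by apply: (@ltNge (f t) z); [apply: zmin => /(_ ft) | exact: fz].
Qed.

Lemma well_founded_family (T U : Type) (lt : T -> T -> Prop)
    (step : T -> set U -> U) : well_founded lt ->
  exists A : T -> U, forall a, A a = step a (A @` [set b | lt b a]).
Proof.
move=> ltwf.
pose F a (rec : forall b, lt b a -> U) :=
  step a [set u | exists b (ba : lt b a), rec b ba = u].
exists (Fix ltwf (fun=> U) F) => a; rewrite Fix_eq => [|b r r' rr'].
  congr (step a _); apply/seteqP; split=> u [b].
    by move=> [ba <-]; exists b.
  by move=> /= ba <-; exists b, ba.
rewrite (_ : r = r') //; apply: functional_extensionality_dep => c.
by apply: functional_extensionality_dep => cb; exact: rr'.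
Qed.

Definition covered (l : seq (nat -> bool)) n := has (fun y : nat -> bool => y n) l.

Definition generated (S : set (nat -> bool)) : set (nat -> bool) :=
  [set x | exists2 l, words S l & almost_le x (covered l)].

Lemma sub_generated S : S `<=` generated S.
Proof.
move=> x Sx; exists [:: x]; first exact/words_cons.
by exists 0 => n _ xn; rewrite /covered /= xn.
Qed.

Lemma words_cat (T : eqType) (W : set T) s t : words W s -> words W t -> words W (s ++ t).
Proof. by move=> Ws Wt x; rewrite mem_cat => /orP[/Ws|/Wt]. Qed.

Lemma generated_ideal S : ideal (generated S).
Proof.
split.
- move=> x y xy [l lS [N yl]]; exists l => //; exists N => n Nn /xy; exact: yl.
- move=> x y [l lS [M xl]] [l' lS' [N yl']].
  exists (l ++ l'); first exact: words_cat.
  exists (maxn M N) => n; rewrite geq_max /covered has_cat => /andP[Mn Nn].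
  by move=> /orP[/(xl n Mn)|/(yl' n Nn)]; rewrite /covered => ->; rewrite ?orbT.
- by move=> N; exists [::] => //; exists N => n; rewrite leqNgt => /negP.
Qed.

Lemma generated_proper S : noncovering S -> ~ generated S xpredT.
Proof.
move=> ncS [l lS [N lN]]; have [n Nn nl] := ncS l lS N.
by have /hasP[y yl yn] := lN n Nn isT; have := nl y yl; rewrite yn.
Qed.

Lemma not_noncovering S : ~ noncovering S ->
  exists2 l, words S l & almost_le xpredT (covered l).
Proof.
move=> /existsNP[l /not_implyP[lS /existsNP[m lm]]]; exists l => //; exists m => n mn _.
apply: contrapT => /negP/hasPn nl; apply: lm; exists n => // y /nl.
Qed.

Lemma ideal_almost_le I x y : ideal I -> almost_le x y -> I y -> I x.
Proof.
move=> [dI uI fI] [N xy] Iy; apply: dI (uI _ _ (fI N) Iy) => n xn.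
by have [//|Nn] := ltnP n N; rewrite xy ?orbT.
Qed.

Lemma ideal_covered I l : ideal I -> words I l -> I (covered l).
Proof.
move=> [dI uI fI]; elim: l => [_|x l IH /words_cons[Ix /IH Il]].
  by apply: dI (fI 0).
exact: uI.
Qed.

Lemma ideal_noncovering I S : ideal I -> ~ I xpredT -> S `<=` I -> noncovering S.
Proof.
move=> idI nI SI; apply: contrapT => /not_noncovering[l lS lN].
apply: nI; apply: (ideal_almost_le idI lN); apply: ideal_covered => //.
by move=> x /lS /SI.
Qed.

(** A finite word over A[Z] has a letter of largest index, and then lies in what is
    already known not to cover. *)
Lemma noncovering_union T (lt : T -> T -> Prop) (A : T -> nat -> bool) (Z : set T) :
  (forall a b, [\/ lt a b, a = b | lt b a]) ->
  (forall a b c, lt a b -> lt b c -> lt a c) ->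
  (forall a, Z a -> noncovering (A @` [set b | lt b a] `|` [set A a])) ->
  noncovering (A @` Z).
Proof.
move=> lt_total lt_trans ncA [_ m|y l lZ]; first by exists m.
suff [a Za la] : exists2 a, Z a & words (A @` [set b | lt b a] `|` [set A a]) (y :: l).
  exact: ncA la.
elim: l y lZ => [|z l IH] y /words_cons[[a Za <-] lZ].
  by exists a => //; apply/words_cons; split=> //; right.
have [b Zb lb] := IH z lZ.
have [ab|e|ba] := lt_total a b.
- by exists b => //; apply/words_cons; split=> //; left; exists a.
- by exists b => //; apply/words_cons; split=> //; right; rewrite e.
exists a => //; apply/words_cons; split; first by right.
move=> w /lb[[c cb <-]|->]; left; last by exists b.
by exists c => //; exact: lt_trans ba.
Qed.

(** By recursion, A a is a pseudo-union of the sequence assigned to stage a that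
    does not make the previous choices covering, if there is one, and empty
    otherwise. A sequence of members of the final ideal never makes the previous
    choices covering, and so it is captured at its stage. *)
Theorem maximal_p_ideal_exists :
  MA_countable -> exists I, maximal_ideal I /\ p_ideal I.
Proof.
move=> MA.
have [lt [f [ltwf lt_total lt_trans fI fshort]]] :=
  short_well_order (nat -> bool : pointedType).
pose task a := row (xget xpred0 [set u | f u = a]).
have task_onto (x : nat -> nat -> bool) : exists a,
    ~ ([set: nat -> bool] #<= [set b | lt b a]) /\ task a = x.
  pose u m := let: (k, n) := Cantor.of_nat m in x k n.
  exists (f u); split=> //; rewrite /task; case: xgetP => [v _ /fI->|/(_ u)/=[]//].
  by apply/funext => k; apply/funext => n; rewrite /row /u Cantor.cancel_of_to.
pose good S (x : nat -> nat -> bool) := [set a |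
  (forall k, almost_le (x k) a) /\ noncovering (S `|` [set a])].
have [A AE] := well_founded_family (fun a S => xget xpred0 (good S (task a))) ltwf.
pose S a := A @` [set b | lt b a].
have ncA a : noncovering (S a `|` [set A a]).
  elim/(well_founded_ind ltwf): a => a IH.
  have ncS : noncovering (S a) by exact: noncovering_union lt_total lt_trans IH.
  rewrite AE -/(S a); case: xgetP => [y _ []//|_].
  move=> l lS m; have [|n mn nl] := ncS [seq y <- l | y != xpred0] _ m.
    by move=> y; rewrite mem_filter => /andP[/eqP y0 /lS[|]].
  exists n => // y yl; have [->//|y0] := eqVneq y xpred0.
  by apply: nl; rewrite mem_filter y0.
pose I := generated (range A).
have idI : ideal I := generated_ideal _.
have AI a : I (A a) by apply: sub_generated; exists a.
have nI : ~ I xpredT.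
  apply: generated_proper; apply: noncovering_union lt_total lt_trans _ => a _.
  exact: ncA.
(* At a stage with fewer than continuum many predecessors a pseudo-union can be
   found as soon as the sequence assigned to it keeps the family noncovering. *)
have capture (x : nat -> nat -> bool) a : ~ ([set: nat -> bool] #<= [set b | lt b a]) ->
    task a = x -> noncovering (S a `|` range x) -> forall k, almost_le (x k) (A a).
  move=> short_a ax ncx; rewrite AE -/(S a) ax.
  have [|y yP] := pseudo_union_exists MA _ ncx.
    by move=> cS; exact/short_a/(card_le_trans cS)/card_image_le.
  by case: xgetP => [z _ [] //|/(_ y)].
(* Maximality is the case of a constant sequence y: either y is captured, or the
   complement of y is almost covered by finitely many previous choices. *)
exists I; split.
  split=> // y; have [a [short_a ay]] := task_onto (fun=> y).
  have [nc|/not_noncovering[l lS lN]] :=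
      pselect (noncovering (S a `|` range (fun _ : nat => y))).
    by left; apply: ideal_almost_le idI _ (AI a); exact: (capture _ _ short_a ay nc 0).
  right; pose l' := [seq z <- l | z != y].
  have Il' : I (covered l').
    apply: ideal_covered => // z; rewrite mem_filter => /andP[/eqP zy /lS[[b _ <-]|[_ _ yz]]].
      exact: AI.
    by case: zy.
  apply: ideal_almost_le idI _ Il'; have [N lN'] := lN; exists N => n Nn yn.
  have /hasP[z zl zn] := lN' n Nn isT; apply/hasP; exists z => //.
  by rewrite mem_filter zl andbT; apply: contraNneq yn => <-.
move=> x Ix; have [a [short_a ax]] := task_onto x.
exists (A a) => //; apply: capture => //.
by apply: (ideal_noncovering idI nI) => _ [[b _ <-]|[k _ <-]].
Qed.

Theorem corollary26 :
  MA_countable ->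
  exists X : set cantor_space,
    ~ Gdelta X /\ countable_dense_homogeneous (omega_power X).
Proof.
move=> /maximal_p_ideal_exists[I [mI pI]]; have [idI _ _] := mI.
exists I; split; first exact: maximal_ideal_not_Gdelta.
apply: omega_power_cdh => //; first exact: power_ideal_p.
exact: power_ideal_swallows.
Qed.
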